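(* Let $[a,b]$ be a compact real interval. For every real-valued function $f\in C[a,b]$, the following are equivalent: (i) For every unital positive linear map of matrix algebras $\phi:\mathcal M\to\mathcal N$ and every self-adjoint operator $A\in\mathcal M$ having spectrum in $[a,b]$, $$\phi(f(A))=f(\phi(A))\implies \phi(A^n)=\phi(A)^n\quad\forall n=1,2,\dots.$$ (ii) $f$ is either strictly convex or strictly concave.
   Context: A matrix algebra is a $C^*$-algebra of the form $\mathcal B(H)$ with $H$ a finite-dimensional (complex) Hilbert space. If $\phi$ is a unital positive linear map and $A$ is self-adjoint with spectrum in $[a,b]$, then $\phi(A)$ is self-adjoint with spectrum in $[a,b]$, so $f(A)$ and $f(\phi(A))$ are defined by the continuous functional calculus. A real function $f\in C[a,b]$ is strictly convex if $f(t x+(1-t)y)<t f(x)+(1-t)f(y)$ for any two distinct points $x\ne y$ in $[a,b]$ and every $t\in(0,1)$; $f$ is strictly concave if $-f$ is strictly convex. *)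

(* Defs.v *)
From HB Require Import structures.
From mathcomp Require Import all_boot all_order all_algebra.
From mathcomp Require Import sesquilinear spectral.
From mathcomp Require Import complex.
From mathcomp Require Import all_classical all_reals all_analysis.

Set Implicit Arguments.
Unset Strict Implicit.
Unset Printing Implicit Defensive.

Import Order.TTheory GRing.Theory Num.Theory.
Import numFieldNormedType.Exports.

Local Open Scope ring_scope.
Local Open Scope complex_scope.

(* The matrix algebra B(H), with H of dimension n, is ['M[R[i]]_n]; its
   self-adjoint elements are the matrices in [hermsymmx]. Following MathComp's
   convention, matrices act on row vectors; this affects neither the spectrum
   nor the functional calculus. *)

Section MatrixAlgebra.
Context {R : realType}.

Definition spectrum_in n (A : 'M[R[i]]_n) (S : set R) : Prop :=
  forall l : R[i], eigenvalue A l -> exists2 x : R, S x & l = x%:C.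

(* Positivity in the sense of C*-algebras *)
Definition positive_mx n (A : 'M[R[i]]_n) : Prop :=
  A \is hermsymmx /\ spectrum_in A [set x : R | 0 <= x]%classic.

Definition positive_map n m (phi : 'M[R[i]]_n -> 'M[R[i]]_m) : Prop :=
  forall A : 'M[R[i]]_n, positive_mx A -> positive_mx (phi A).

Definition unital_map n m (phi : 'M[R[i]]_n -> 'M[R[i]]_m) : Prop :=
  phi 1%:M = 1%:M.

(* The continuous functional calculus f(A) for self-adjoint A. With
   P = spectralmx A unitary and d = spectral_diag A, the spectral theorem
   (orthomx_spectralP) gives A = P^-1 diag(d) P, and the entries of d are real
   (hermitian_spectral_diag_real), so that Re loses nothing. The value is
   meaningful only when A is self-adjoint. *)
Definition funcalc (f : R -> R) n (A : 'M[R[i]]_n) : 'M[R[i]]_n :=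
  invmx (spectralmx A)
  *m diag_mx (map_mx (fun z : R[i] => (f (complex.Re z))%:C) (spectral_diag A))
  *m spectralmx A.

Definition strictly_convex_on (a b : R) (f : R -> R) : Prop :=
  forall x y t : R, x \in `[a, b] -> y \in `[a, b] -> x != y ->
    t \in `]0, 1[ ->
    f (t * x + (1 - t) * y) < t * f x + (1 - t) * f y.

Definition strictly_concave_on (a b : R) (f : R -> R) : Prop :=
  strictly_convex_on a b (fun x => - f x).

End MatrixAlgebra.

(* Main.v *)
(* Let f be strictly convex, A = sum_i x_i P_i with P_i the rank one spectral
   projections, and let v be a unit eigenvector of phi(A) for the eigenvalue mu.
   The numbers w_i = <v, phi(P_i) v> are probability weights with mean
   sum_i w_i x_i = mu, and phi(f(A)) = f(phi(A)) says that Jensen's inequality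
   for them is an equality, so w_i = 0 whenever x_i != mu. As phi(P_i) is
   positive, w_i = 0 forces phi(P_i) v = 0, hence
   phi(A^k) v = sum_i x_i^k phi(P_i) v = mu^k v.

   Conversely, if f is neither strictly convex nor strictly concave, the
   convexity defect takes both signs, so by connectedness
   f(t x + (1 - t) y) = t f(x) + (1 - t) f(y) for some x < y and 0 < t < 1. The
   state M |-> t M_00 + (1 - t) M_11 and A = diag(x, y) then violate (i), the
   failure for A^2 being t (1 - t) (y - x)^2 != 0. *)
Require Import Defs.
From HB Require Import structures.
From mathcomp Require Import all_boot all_order all_algebra.
From mathcomp Require Import sesquilinear spectral.
From mathcomp Require Import complex.
From mathcomp Require Import all_classical all_reals all_analysis.
From mathcomp Require Import ring lra.

Set Implicit Arguments.
Unset Strict Implicit.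
Unset Printing Implicit Defensive.

Import Order.TTheory GRing.Theory Num.Theory.
Import numFieldNormedType.Exports.

Local Open Scope classical_set_scope.
Local Open Scope ring_scope.
Local Open Scope complex_scope.

(** * Jensen's inequality and its equality case for finitely many weights *)

Section Jensen.
Context {R : realType} (a b : R) (f : R -> R)
  (fconv : strictly_convex_on a b f).

Lemma convex_comb_itv (t x y : R) : t \in `[0, 1] ->
  x \in `[a, b] -> y \in `[a, b] -> t * x + (1 - t) * y \in `[a, b].
Proof.
rewrite !in_itv /= => /andP[t0 t1] /andP[ax xb] /andP[ay yb].
have u0 : 0 <= 1 - t by lra.
have h1 : 0 <= t * (x - a) by rewrite mulr_ge0// subr_ge0.
have h2 : 0 <= t * (b - x) by rewrite mulr_ge0// subr_ge0.
have h3 : 0 <= (1 - t) * (y - a) by rewrite mulr_ge0// subr_ge0.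
have h4 : 0 <= (1 - t) * (b - y) by rewrite mulr_ge0// subr_ge0.
by apply/andP; split; nra.
Qed.

Lemma strictly_convexW (t x y : R) : t \in `[0, 1] ->
  x \in `[a, b] -> y \in `[a, b] ->
  f (t * x + (1 - t) * y) <= t * f x + (1 - t) * f y.
Proof.
move=> t01 xab yab; have [->|xy] := eqVneq x y.
  by rewrite -!mulrDl addrC subrK !mul1r.
move: t01; rewrite in_itv /= => /andP[].
rewrite le_eqVlt => /predU1P[<-|t0]; first by rewrite !mul0r !add0r subr0 !mul1r.
rewrite le_eqVlt => /predU1P[->|t1].
  by rewrite subrr !mul0r !addr0 !mul1r.
by apply/ltW/fconv => //; rewrite in_itv /= t0.
Qed.

(** Dividing by [W] lets the weights have any positive total, so the induction on [s] can drop a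
    term; the filter [P] later serves to leave out one index. Membership of the mean in the interval
    is what allows convexity to be used at the next step. *)
Lemma jensen (I : Type) (s : seq I) (P : pred I) (w x : I -> R) :
  (forall i, 0 <= w i) -> (forall i, x i \in `[a, b]) ->
  let W := \sum_(i <- s | P i) w i in 0 < W ->
  (\sum_(i <- s | P i) w i * x i) / W \in `[a, b] /\
  f ((\sum_(i <- s | P i) w i * x i) / W) <=
    (\sum_(i <- s | P i) w i * f (x i)) / W.
Proof.
move=> w0 xab /=; elim: s => [|i s IH]; first by rewrite !big_nil ltxx.
rewrite !big_cons; case: ifP => // _.
set W := \sum_(_ <- _ | _) _; set X := \sum_(_ <- _ | _) _.
set Y := \sum_(_ <- _ | _) _ => W0.
have : 0 <= W by exact: sumr_ge0.
rewrite le_eqVlt => /predU1P[We|Wpos].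
  (* The remaining weights have sum zero, so all of them vanish and the mean is [x i] alone. *)
  have z (g : I -> R) : \sum_(i <- s | P i) w i * g i = 0.
    have /eqP : W = 0 by [].
    rewrite /W; elim: (s) => [|k r IHr]; first by rewrite !big_nil.
    rewrite !big_cons; case: ifP => // _.
    rewrite paddr_eq0 ?sumr_ge0// => /andP[/eqP-> /IHr->].
    by rewrite mul0r addr0.
  rewrite /X /Y !z // -We !addr0.
  have wi : w i != 0 by rewrite -We addr0 in W0; rewrite gt_eqF.
  by rewrite mulrAC divff// mul1r mulrAC divff// mul1r.
have [mab fm] := IH Wpos.
(* The relative weight of the new point: the new mean is the convex combination of [x i] and the old
   mean with coefficient [t]. *)
pose t := w i / (w i + W).
have n1 : w i + W != 0 by rewrite gt_eqF.
have n2 : W != 0 by rewrite gt_eqF.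
have t01 : t \in `[0, 1].
  rewrite in_itv /= /t divr_ge0 ?(ltW W0)//= ler_pdivrMr// mul1r; lra.
have e z Z : (w i * z + Z) / (w i + W) = t * z + (1 - t) * (Z / W).
  by rewrite /t; field; rewrite n1 n2.
rewrite !e; split; first exact: convex_comb_itv.
apply: le_trans (strictly_convexW t01 (xab i) mab) _.
rewrite lerD2l ler_wpM2l//; move: t01; rewrite in_itv /=; lra.
Qed.

(** Group all indices other than [i] into one point, their mean. If [x i] is not the total mean, it
    differs from that point, and strict convexity at these two points, followed by Jensen for the
    others, makes the inequality strict. *)
Lemma strict_jensen (I : finType) (w x : I -> R) :
  (forall i, 0 <= w i) -> (forall i, x i \in `[a, b]) -> \sum_i w i = 1 ->
  f (\sum_i w i * x i) = \sum_i w i * f (x i) ->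
  forall i, w i != 0 -> x i = \sum_j w j * x j.
Proof.
move=> w0 xab w1 fE i wi; apply/eqP/negPn/negP => xi.
have wpos : 0 < w i by rewrite lt0r wi w0.
have D (g : I -> R) : \sum_j g j = g i + \sum_(j | j != i) g j.
  by rewrite (bigD1 i).
move: w1 fE xi; rewrite !D.
set W := \sum_(_ | _) _; set X := \sum_(_ | _) _; set Y := \sum_(_ | _) _.
move=> w1; have : 0 <= W by exact: sumr_ge0.
rewrite le_eqVlt => /predU1P[We _|Wpos fE].
  have z j : j != i -> w j = 0.
    by move: j; apply/psumr_eq0P => //; rewrite -We.
  rewrite /X big1 => [|j ji]; last by rewrite z// mul0r.
  by move: w1; rewrite -We !addr0 => ->; rewrite mul1r eqxx.
have := @jensen _ (index_enum I) (fun j => j != i) w x w0 xab Wpos.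
rewrite -/X -/Y => -[mab fm] xi.
have n2 : W != 0 by rewrite gt_eqF.
have xm : x i != X / W.
  apply: contra xi => /eqP xe; rewrite -[X](divfK n2) -xe.
  by rewrite [X in _ + X]mulrC -mulrDl w1 mul1r.
have w01 : w i \in `]0, 1[ by rewrite in_itv /= wpos; lra.
have := fconv (xab i) mab xm w01.
have -> : 1 - w i = W by lra.
have e Z : W * (Z / W) = Z by rewrite mulrC divfK.
rewrite e fE ltNge => /negP; apply; rewrite lerD2l.
by rewrite -[leRHS]e ler_wpM2l// ltW.
Qed.

End Jensen.

(** * An affine coincidence for functions neither strictly convex nor strictly concave *)

(* The triple (x, y, t) moves along a segment from (x0, y0, t0) to (x1, y1, t1),
   inside the convex set a <= x < y <= b, 0 < t < 1, and the convexity defect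
   changes sign along the way. *)
Lemma convexity_defect_path (R : realType) (a b : R) (f : R -> R) :
    {within `[a, b], continuous f} ->
    forall x0 y0 t0 x1 y1 t1 : R,
    x0 \in `[a, b] -> y0 \in `[a, b] -> t0 \in `]0, 1[ -> x0 < y0 ->
    x1 \in `[a, b] -> y1 \in `[a, b] -> t1 \in `]0, 1[ -> x1 < y1 ->
    t0 * f x0 + (1 - t0) * f y0 <= f (t0 * x0 + (1 - t0) * y0) ->
    f (t1 * x1 + (1 - t1) * y1) <= t1 * f x1 + (1 - t1) * f y1 ->
  exists x y t : R, [/\ x \in `[a, b], y \in `[a, b], x < y, t \in `]0, 1[ &
    f (t * x + (1 - t) * y) = t * f x + (1 - t) * f y].
Proof.
move=> cf x0 y0 t0 x1 y1 t1 x0ab y0ab t0i xy0 x1ab y1ab t1i xy1 f0 f1.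
pose p (u v s : R) := s * v + (1 - s) * u.
have pc u v : continuous (p u v : R -> R).
  move=> s; apply: cvgD; first by apply: cvgM; [exact: cvg_id|exact: cvg_cst].
  apply: cvgM; last exact: cvg_cst.
  by apply: cvgB; [exact: cvg_cst|exact: cvg_id].
have pab u v s : u \in `[a, b] -> v \in `[a, b] -> s \in `[0, 1] ->
    p u v s \in `[a, b].
  by move=> ? ? ?; exact: convex_comb_itv.
(* The strict constraints [0 < T], [0 < 1 - T] and [0 < Y - X] persist along the path, as each of
   these quantities is itself affine in [s] and positive at both ends. *)
have p_gt0 u v s : s \in `[0, 1] -> 0 < u -> 0 < v -> 0 < p u v s.
  rewrite in_itv /= /p => /andP[? ?] ? ?.
  by have [?|?] := leP u v; nra.
pose T := p t0 t1; pose X := p x0 x1; pose Y := p y0 y1.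
have Ti s : s \in `[0, 1] -> T s \in `]0, 1[.
  move=> s01; move: t0i t1i; rewrite !in_itv /= => /andP[? ?] /andP[? ?].
  rewrite p_gt0//= -subr_gt0.
  have -> : 1 - T s = p (1 - t0) (1 - t1) s by rewrite /T /p; ring.
  by rewrite p_gt0// subr_gt0.
have XY s : s \in `[0, 1] -> X s < Y s.
  move=> s01; rewrite -subr_gt0.
  have -> : Y s - X s = p (y0 - x0) (y1 - x1) s by rewrite /X /Y /p; ring.
  by rewrite p_gt0// subr_gt0.
pose Z s := T s * X s + (1 - T s) * Y s.
have Zab s : s \in `[0, 1] -> Z s \in `[a, b].
  move=> s01; apply: convex_comb_itv; try exact: pab.
  by apply: subset_itv_oo_cc; exact: Ti.
have Zc : continuous (Z : R -> R).
  move=> s; apply: cvgD; apply: cvgM; try exact: pc.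
  by apply: cvgB; [exact: cvg_cst|exact: pc].
(* [f] is continuous only relative to the interval, so composition needs [h] to stay inside it. *)
have fc (h : R -> R) : continuous h ->
    (forall s, s \in `[0, 1] -> h s \in `[a, b]) ->
    {within `[0, 1], continuous (f \o h)}.
  move=> ch hab; apply/subspace_continuousP => s s01.
  move/subspace_continuousP : cf => /(_ (h s) (hab _ s01)) cfs.
  apply: cvg_comp cfs => U HU.
  have H : nbhs s (fun u => h u \in `[a, b] -> U (h u)) by exact: (ch s _ HU).
  change (nbhs s (fun u => u \in `[0, 1] -> U (h u))).
  by apply: filterS H => u Hu u01; apply: Hu; exact: hab.
pose g s := f (Z s) - (T s * f (X s) + (1 - T s) * f (Y s)).
have gc : {within `[0, 1], continuous g}.
  have Tw : {within `[0, 1], continuous T}.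
    by apply: continuous_subspaceT; exact: pc.
  have Xw : {within `[0, 1], continuous (f \o X)}.
    by apply: fc; [exact: pc|move=> s; exact: pab].
  have Yw : {within `[0, 1], continuous (f \o Y)}.
    by apply: fc; [exact: pc|move=> s; exact: pab].
  have Zw : {within `[0, 1], continuous (f \o Z)} by exact: fc.
  move=> s; apply: cvgB; first exact: Zw.
  apply: cvgD; apply: cvgM; [exact: Tw|exact: Xw| |exact: Yw].
  by apply: cvgB; [exact: cvg_cst|exact: Tw].
have p0 u v : p u v 0 = u by rewrite /p; lra.
have p1 u v : p u v 1 = v by rewrite /p; lra.
have g0 : 0 <= g 0 by rewrite /g /Z /T /X /Y !p0 subr_ge0.
have g1 : g 1 <= 0 by rewrite /g /Z /T /X /Y !p1 subr_le0.
have [|s s01 /subr0_eq gs] := @IVT R g 0 1 0 ler01 gc.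
  by rewrite ge_min g1 orbT le_max g0.
exists (X s), (Y s), (T s); split=> //; [exact: pab|exact: pab|exact: XY|exact: Ti].
Qed.

(** Exchanging [x] with [y] and [t] with [1 - t] gives the order [x < y], which the path argument
    needs at both ends. *)
Lemma not_strictly_convexP (R : realType) (a b : R) (f : R -> R) :
  ~ strictly_convex_on a b f ->
  exists x y t : R, [/\ x \in `[a, b], y \in `[a, b], t \in `]0, 1[, x < y &
    t * f x + (1 - t) * f y <= f (t * x + (1 - t) * y)].
Proof.
move=> nf; apply: contrapT => nex; apply: nf => x y t xab yab xy ti.
rewrite ltNge; apply/negP => le; apply: nex.
have [xLy|yLx] : x < y \/ y < x by apply/orP; rewrite -neq_lt.
  by exists x, y, t.
exists y, x, (1 - t); split=> //.
  by move: ti; rewrite !in_itv /=; lra.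
have -> : 1 - (1 - t) = t by lra.
by rewrite addrC [in leRHS]addrC.
Qed.

Lemma neither_convex_nor_concave (R : realType) (a b : R) (f : R -> R) :
    {within `[a, b], continuous f} ->
    ~ strictly_convex_on a b f -> ~ strictly_concave_on a b f ->
  exists x y t : R, [/\ x \in `[a, b], y \in `[a, b], x < y, t \in `]0, 1[ &
    f (t * x + (1 - t) * y) = t * f x + (1 - t) * f y].
Proof.
move=> cf /not_strictly_convexP[x0 [y0 [t0 [? ? ? ? f0]]]].
move=> /not_strictly_convexP[x1 [y1 [t1 [? ? ? ? f1]]]].
apply: (@convexity_defect_path _ a b f cf x0 y0 t0 x1 y1 t1) => //; lra.
Qed.


Local Open Scope sesquilinear_scope.

(** * Diagonalized matrices and quadratic forms *)

Section ClosedField.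
Context {C : numClosedFieldType}.

Lemma trmxC_mul n m p (M : 'M[C]_(n, m)) (N : 'M[C]_(m, p)) :
  (M *m N) ^t* = N ^t* *m M ^t*.
Proof. by rewrite trmx_mul map_mxM. Qed.

Lemma row_eigen n (P : 'M[C]_n) (e : 'rV[C]_n) j : P \in unitmx ->
  row j P *m (invmx P *m diag_mx e *m P) = e 0 j *: row j P.
Proof.
move=> Pu; rewrite -row_mul !mulmxA mulmxV// mul1mx.
by apply/rowP => k; rewrite mxE mul_diag_mx !mxE.
Qed.

Lemma row_unit_neq0 n (P : 'M[C]_n) j : P \in unitmx -> row j P != 0.
Proof.
move=> Pu; apply/eqP => r0; have : row j (P *m invmx P) = 0.
  by rewrite row_mul r0 mul0mx.
rewrite mulmxV// => /rowP/(_ j); rewrite !mxE eqxx => /eqP.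
by rewrite oner_eq0.
Qed.

(** Turns equality of two diagonalized matrices into an entrywise condition on the change of basis
    [Q *m invmx P]. *)
Lemma intertwine_diag n (P Q : 'M[C]_n) (d e : 'rV[C]_n) :
    P \in unitmx -> Q \in unitmx ->
  (invmx Q *m diag_mx d *m Q = invmx P *m diag_mx e *m P) <->
  (Q *m invmx P *m diag_mx e = diag_mx d *m (Q *m invmx P)).
Proof.
move=> Pu Qu; split=> E.
  rewrite -[LHS](mulmxK Pu) -!mulmxA (mulmxA (invmx P)) (mulmxA _ P) -E.
  by rewrite !mulmxA mulmxV// mul1mx.
rewrite -!mulmxA -[RHS](mulKmx Qu); congr (_ *m _).
by rewrite !mulmxA E !mulmxA mulmxKV.
Qed.

Lemma exp_diagonalized n (P : 'M[C]_n) (e : 'rV[C]_n) k : P \in unitmx ->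
  (invmx P *m diag_mx e *m P) ^+ k =
  invmx P *m diag_mx (map_mx (fun z => z ^+ k) e) *m P.
Proof.
move=> Pu; elim: k => [|k IH].
  have -> : map_mx (fun z => z ^+ 0) e = const_mx 1.
    by apply/rowP => j; rewrite !mxE.
  by rewrite diag_const_mx mulmx1 mulVmx.
rewrite exprS IH -[LHS]/(_ *m _) -!mulmxA (mulmxA P) mulmxV// mul1mx.
congr (_ *m _); rewrite !mulmxA mulmx_diag; congr (diag_mx _ *m _).
by apply/rowP => j; rewrite !mxE exprS.
Qed.

(** The quadratic form of [M] at a row vector; [quad 1%:M v] is the squared norm of [v]. *)
Definition quad n (M : 'M[C]_n) (v : 'rV[C]_n) : C := (v *m M *m v ^t*) 0 0.

Lemma quad1 n (v : 'rV[C]_n) : quad 1%:M v = \sum_k `|v 0 k| ^+ 2.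
Proof.
by rewrite /quad mulmx1 mxE; apply: eq_bigr => k _; rewrite !mxE normCK.
Qed.

Lemma quad1_gt0 n (v : 'rV[C]_n) : v != 0 -> 0 < quad 1%:M v.
Proof.
move=> v0; rewrite quad1 lt0r sumr_ge0 ?andbT; last by move=> *; rewrite exprn_ge0.
apply: contra v0 => /eqP/psumr_eq0P v0; apply/eqP/rowP => k; rewrite mxE.
by apply/eqP; rewrite -normr_eq0 -sqrf_eq0 v0// => *; rewrite exprn_ge0.
Qed.

Lemma quad_sum n (I : finType) (c : I -> C) (E : I -> 'M[C]_n) v :
  quad (\sum_i c i *: E i) v = \sum_i c i * quad (E i) v.
Proof.
rewrite /quad mulmx_sumr mulmx_suml summxE; apply: eq_bigr => i _.
by rewrite -scalemxAr -scalemxAl mxE.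
Qed.

Lemma quad_eigen n (M : 'M[C]_n) (v : 'rV[C]_n) l :
  v *m M = l *: v -> quad M v = l * quad 1%:M v.
Proof. by move=> vM; rewrite /quad vM -scalemxAl mxE mulmx1. Qed.

(** The spectral decomposition: each summand is the orthogonal projection onto the line of a row of
    [P]. *)
Lemma diagonalized_sum n (P : 'M[C]_n) (e : 'rV[C]_n) : P \is unitarymx ->
  invmx P *m diag_mx e *m P = \sum_j e 0 j *: ((row j P) ^t* *m row j P).
Proof.
move=> Pu; rewrite invmx_unitary//; apply/matrixP => i k.
rewrite mul_mx_diag mxE summxE; apply: eq_bigr => j _.
by rewrite !mxE big_ord1 !mxE mulrAC mulrC mulrA.
Qed.

End ClosedField.

(** * Functional calculus and positive matrices *)

Section Matrices.
Context {R : realType}.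
Local Notation C := R[i].

Lemma hermsymmxP n (M : 'M[C]_n) : (M \is hermsymmx) <-> M ^t* = M.
Proof.
split=> [/is_hermitianmxP|] h; first by rewrite {2}h expr0 scale1r.
by apply/is_hermitianmxP; rewrite expr0 scale1r.
Qed.

Lemma spectrum_spectral_diag n (A : 'M[C]_n) (S : set R) :
    A \is hermsymmx -> spectrum_in A S ->
  forall j, exists2 x : R, S x & spectral_diag A 0 j = x%:C.
Proof.
move=> /hermitian_normalmx /orthomx_spectralP AE SA j; apply: SA.
apply/eigenvalueP; exists (row j (spectralmx A)).
  by rewrite {2}AE row_eigen ?spectral_unit.
exact/row_unit_neq0/spectral_unit.
Qed.

(* An entry of the change of basis between two diagonalizations vanishes unless
   it joins equal eigenvalues, hence it also intertwines the values of f. *)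
Lemma funcalc_unique n (f : R -> R) (A P : 'M[C]_n) (x : 'I_n -> R) :
    A \is hermsymmx -> P \in unitmx ->
    A = invmx P *m diag_mx (\row_j (x j)%:C) *m P ->
  funcalc f A = invmx P *m diag_mx (\row_j (f (x j))%:C) *m P.
Proof.
move=> Ah Pu AE; rewrite /funcalc.
have /orthomx_spectralP := hermitian_normalmx Ah; rewrite {1}AE => /esym.
have := spectral_unit A; move: (spectralmx A) (spectral_diag A) => Q d Qu.
move/(intertwine_diag _ _ Pu Qu) => XE; apply/intertwine_diag => //.
move: (Q *m invmx P) XE => X XE.
apply/matrixP => i j; rewrite mul_mx_diag mul_diag_mx !mxE.
move/matrixP/(_ i j): XE; rewrite mul_mx_diag mul_diag_mx !mxE mulrC.
move=> /eqP; rewrite -subr_eq0 -mulrBl mulf_eq0 subr_eq0.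
by case/orP => /eqP h; rewrite -?h /= ?h ?mul0r ?mulr0 // mulrC.
Qed.

(** In an orthonormal eigenbasis the form is a sum of nonnegative terms, eigenvalue times squared
    coordinate of [v]. If the sum is zero, each term is, so [M] kills every component of [v]. *)
Lemma quad_positive n (M : 'M[C]_n) (v : 'rV[C]_n) : positive_mx M ->
  0 <= quad M v /\ (quad M v = 0 -> v *m M = 0).
Proof.
case=> Mh /(spectrum_spectral_diag Mh).
have /orthomx_spectralP := hermitian_normalmx Mh.
have := spectral_unitarymx M.
move: (spectralmx M) (spectral_diag M) => Q d Qun ME dE.
have d0 k : 0 <= d 0 k by have [x x0 ->] := dE k; rewrite ler0c.
pose u := v *m Q ^t*.
rewrite invmx_unitary // in ME.
have qE : quad M v = \sum_k d 0 k * `|u 0 k| ^+ 2.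
  rewrite /quad {1}ME !mulmxA -/u -mulmxA.
  have -> : Q *m v ^t* = u ^t* by rewrite trmxC_mul trmxCK.
  rewrite mul_mx_diag mxE; apply: eq_bigr => k _.
  by rewrite !mxE normCK mulrA [d 0 k * _]mulrC.
have t0 k : true -> 0 <= d 0 k * `|u 0 k| ^+ 2 by rewrite mulr_ge0 ?exprn_ge0.
rewrite qE; split; first exact: sumr_ge0.
move=> /psumr_eq0P => /(_ t0) z.
have ud : u *m diag_mx d = 0.
  apply/rowP => k; rewrite mul_mx_diag mxE [RHS]mxE.
  have /eqP := z k isT; rewrite mulf_eq0 sqrf_eq0 normr_eq0.
  by case/orP => /eqP ->; rewrite ?mulr0 ?mul0r.
by rewrite ME !mulmxA -/u ud mul0mx.
Qed.

(** For an eigenvector [u], the eigenvalue times the squared norm of [u] is the squared modulus of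
    the inner product of [u] and [v]. *)
Lemma positive_mx_outer n (v : 'rV[C]_n) : positive_mx (v ^t* *m v).
Proof.
split; first by apply/hermsymmxP; rewrite trmxC_mul trmxCK.
move=> l /eigenvalueP[u ul u0].
have := quad_eigen ul.
have -> : quad (v ^t* *m v) u = `|(u *m v ^t*) 0 0| ^+ 2.
  rewrite /quad mulmxA -mulmxA.
  have -> : v *m u ^t* = (u *m v ^t*) ^t* by rewrite trmxC_mul trmxCK.
  by rewrite mxE big_ord1 !mxE normCK.
move=> E; have l0 : 0 <= l.
  by rewrite -(pmulr_lge0 _ (quad1_gt0 u0)) -E exprn_ge0.
exists (complex.Re l); last by rewrite RRe_real// ger0_real.
by rewrite /= -ler0c RRe_real// ger0_real.
Qed.

End Matrices.

(** * From equality in Jensen to preservation of powers *)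

Section MainDirections.
Context {R : realType}.
Local Notation C := R[i].

Lemma funcalc_opp n (f : R -> R) (A : 'M[C]_n) :
  funcalc (fun x => - f x) A = - funcalc f A.
Proof.
rewrite /funcalc -mulNmx -mulmxN; congr (_ *m _ *m _).
apply/matrixP => i j; rewrite !mxE -mulNrn; congr (_ *+ _).
by rewrite (rmorphN (real_complex R)).
Qed.

Lemma power_equality n m (phi : {linear 'M[C]_n -> 'M[C]_m})
    (a b : R) (f : R -> R) :
    strictly_convex_on a b f -> unital_map phi -> positive_map phi ->
    forall A : 'M[C]_n, A \is hermsymmx -> spectrum_in A `[a, b] ->
    phi (funcalc f A) = funcalc f (phi A) ->
  forall k, phi (A ^+ k) = phi A ^+ k.
Proof.
move=> fc phi1 phip A Ah As; rewrite /funcalc.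
have /orthomx_spectralP := hermitian_normalmx Ah.
have Pun := spectral_unitarymx A; have Pu := spectral_unit A.
have := spectrum_spectral_diag Ah As.
move: (spectralmx A) (spectral_diag A) Pun Pu => P d Pun Pu dE AE.
have [x xab {}dE] := fin_all_exists2 dE.
pose E i := phi ((row i P) ^t* *m row i P).
have Ep i : positive_mx (E i) by apply/phip/positive_mx_outer.
have phiE (e : 'rV[C]_n) :
    phi (invmx P *m diag_mx e *m P) = \sum_i e 0 i *: E i.
  rewrite diagonalized_sum// linear_sum.
  by apply: eq_bigr => i _; rewrite linearZ.
have E1 : \sum_i E i = 1%:M.
  transitivity (phi (invmx P *m diag_mx (const_mx 1) *m P)).
    by rewrite phiE; apply: eq_bigr => i _; rewrite mxE scale1r.
  by rewrite diag_const_mx mulmx1 mulVmx.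
have phiA : phi A = \sum_i (x i)%:C *: E i.
  by rewrite AE phiE; apply: eq_bigr => i _; rewrite dE.
have phiAk k : phi (A ^+ k) = \sum_i (x i)%:C ^+ k *: E i.
  by rewrite AE exp_diagonalized// phiE; apply: eq_bigr => i _; rewrite mxE dE.
(* [phi A] is a real combination of the positive, hence self-adjoint, matrices [E i]. *)
have Bh : phi A \is hermsymmx.
  apply/hermsymmxP; rewrite phiA raddf_sum map_mx_sum.
  apply: eq_bigr => i _; have [/hermsymmxP Eh _] := Ep i.
  by rewrite /= linearZ map_mxZ Eh; congr (_ *: _); exact: conjc_real.
rewrite phiE.
have /orthomx_spectralP := hermitian_normalmx Bh.
have Qun := spectral_unitarymx (phi A); have Qu := spectral_unit (phi A).
have := hermitian_spectral_diag_real Bh.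
move: (spectralmx _) (spectral_diag (phi A)) Qun Qu => Q mu Qun Qu mur BE fE k.
(* The rows of [Q] form an eigenbasis of [phi A], so it suffices to compare both sides on them. *)
suff H j : row j Q *m phi (A ^+ k) = row j Q *m phi A ^+ k.
  apply: (can_inj (mulKmx Qu)); apply/row_matrixP => j.
  by rewrite !row_mul H.
pose v := row j Q; rewrite -/v.
have v1 : quad 1%:M v = 1.
  have /unitarymxP/matrixP/(_ j j) := Qun.
  rewrite [RHS]mxE eqxx mulr1n => QQ; apply: etrans QQ.
  by rewrite /quad mulmx1 !mxE; apply: eq_bigr => i _; rewrite !mxE.
pose w i := complex.Re (quad (E i) v).
have wE i : quad (E i) v = (w i)%:C.
  by rewrite RRe_real// ger0_real//; have [] := quad_positive v (Ep i).
have w0 i : 0 <= w i.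
  by rewrite -ler0c -wE; have [] := quad_positive v (Ep i).
(* Pairing an eigenvector equation with the unit vector [v] turns it into a weighted mean. It is
   applied with [g] equal to 1, to [x] and to [f] of [x], giving total mass, mean and equality in
   Jensen. *)
have qs (g : 'I_n -> R) l : v *m (\sum_i (g i)%:C *: E i) = l *: v ->
    \sum_i w i * g i = complex.Re l.
  move=> /quad_eigen; rewrite v1 mulr1 quad_sum => <-.
  under [in RHS]eq_bigr do rewrite wE -rmorphM.
  by rewrite -rmorph_sum/=; apply: eq_bigr => i _; rewrite mulrC.
have s1 : \sum_i w i = 1.
  rewrite -[RHS]/(complex.Re (1 : C)) -(qs (fun=> 1)).
    by apply: eq_bigr => i _; rewrite mulr1.
  rewrite scale1r -[RHS]mulmx1 -E1; congr (_ *m _).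
  by apply: eq_bigr => i _; rewrite scale1r.
have vB : v *m phi A = mu 0 j *: v by rewrite BE row_eigen.
have sx : \sum_i w i * x i = complex.Re (mu 0 j) by apply: qs; rewrite -phiA.
have muE : mu 0 j = (complex.Re (mu 0 j))%:C.
  by rewrite RRe_real//; exact: (mxOverP mur).
have sf : \sum_i w i * f (x i) = f (complex.Re (mu 0 j)).
  rewrite -[RHS]/(complex.Re (f (complex.Re (mu 0 j)))%:C); apply: qs.
  transitivity (v *m
      \sum_i map_mx (fun z : C => (f (complex.Re z))%:C) d 0 i *: E i).
    by congr (_ *m _); apply: eq_bigr => i _; rewrite mxE dE.
  by rewrite fE row_eigen// mxE.
have xw := strict_jensen fc w0 xab s1 (etrans (congr1 f sx) (esym sf)).
(* Either [w i] is zero and positivity of [E i] makes both sides vanish, or equality in Jensen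
   forces [x i] to be the eigenvalue. *)
have vE i : v *m ((x i)%:C ^+ k *: E i) = mu 0 j ^+ k *: (v *m E i).
  rewrite -scalemxAr; have [wi|wi] := eqVneq (w i) 0.
    have [_ ->] := quad_positive v (Ep i); first by rewrite !scaler0.
    by rewrite wE wi.
  by rewrite (xw i wi) sx -muE.
rewrite phiAk mulmx_sumr (eq_bigr _ (fun i _ => vE i)).
rewrite -scaler_sumr -mulmx_sumr E1 mulmx1.
elim: (k) => [|l IH]; first by rewrite !expr0 mulmx1 scale1r.
rewrite exprSr exprS -[phi A * _]/(_ *m _) mulmxA vB -scalemxAl -IH scalerA.
by rewrite mulrC.
Qed.

(** * The counterexample: a diagonal state on two by two matrices *)

Definition two_point_state (t : R) (M : 'M[C]_2) : 'M[C]_1 :=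
  (t%:C * M 0 0 + (1 - t)%:C * M 1 1)%:M.

Fact two_point_state_is_linear t : linear (two_point_state t).
Proof.
move=> c M N; apply/matrixP => i j; rewrite !ord1 !mxE eqxx !mulr1n.
by rewrite /GRing.scale /=; ring.
Qed.

HB.instance Definition _ t := GRing.isLinear.Build C _ _ _ (two_point_state t)
  (two_point_state_is_linear t).

Lemma two_point_state_unital t : unital_map (two_point_state t).
Proof.
rewrite /unital_map /two_point_state !mxE !eqxx !mulr1 -rmorphD.
by congr ((real_complex R _)%:M); ring.
Qed.

Lemma positive_mx_diag_ge0 n (M : 'M[C]_n) i : positive_mx M -> 0 <= M i i.
Proof.
move=> /(quad_positive (delta_mx 0 i))[+ _]; rewrite /quad -rowE !mxE.
rewrite (bigD1 i)//= !mxE !eqxx conjC1 mulr1 big1 ?addr0// => k ki.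
by rewrite !mxE (negbTE ki) conjC0 mulr0.
Qed.

Lemma two_point_state_positive t :
  t \in `[0, 1] -> positive_map (two_point_state t).
Proof.
rewrite in_itv /= => /andP[t0 t1] M Mp.
have : 0 <= t%:C * M 0 0 + (1 - t)%:C * M 1 1.
  by rewrite addr_ge0// mulr_ge0 ?positive_mx_diag_ge0// ler0c// subr_ge0.
rewrite /two_point_state; move: (_ + _) => z z0.
have zr : z \is Num.real by rewrite ger0_real.
split.
  by apply/hermsymmxP; rewrite tr_scalar_mx map_scalar_mx/= (CrealP zr).
move=> l /eigenvalueP[u]; rewrite mul_mx_scalar => /eqP.
rewrite -subr_eq0 -scalerBl scaler_eq0 => /orP[|/eqP->]; last by rewrite eqxx.
rewrite subr_eq0 => /eqP <- _; exists (complex.Re z); last by rewrite RRe_real.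
by rewrite /= -ler0c RRe_real.
Qed.

Lemma diag_mx_hermitian n (x : 'I_n -> R) :
  diag_mx (\row_i (x i)%:C : 'rV[C]_n) \is hermsymmx.
Proof.
apply/hermsymmxP; rewrite tr_diag_mx map_diag_mx; congr diag_mx.
by apply/rowP => i; rewrite !mxE; exact: conjc_real.
Qed.

Lemma diag_mx_spectrum n (x : 'I_n -> R) (S : set R) : (forall i, S (x i)) ->
  spectrum_in (diag_mx (\row_i (x i)%:C : 'rV[C]_n)) S.
Proof.
move=> xS l /eigenvalueP[u ul u0].
have [i ui] : exists i, u 0 i != 0.
  apply: contrapT => nu; move/negP: u0; apply; apply/eqP/rowP => i.
  by rewrite mxE; apply/eqP/negPn/negP => ui; apply: nu; exists i.
exists (x i) => //; move/rowP/(_ i): ul; rewrite mul_mx_diag !mxE mulrC.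
by move/(mulIf ui).
Qed.

Lemma funcalc_diag n (f : R -> R) (x : 'I_n -> R) :
  funcalc f (diag_mx (\row_i (x i)%:C)) = diag_mx (\row_i (f (x i))%:C).
Proof.
rewrite (@funcalc_unique _ _ f _ 1%:M x) ?unitmx1 ?diag_mx_hermitian//.
  by rewrite invmx1 mul1mx mulmx1.
by rewrite invmx1 mul1mx mulmx1.
Qed.

Lemma affine_counterexample (f : R -> R) (x y t : R) : x < y -> t \in `]0, 1[ ->
    f (t * x + (1 - t) * y) = t * f x + (1 - t) * f y ->
  let A := diag_mx (\row_(i < 2) (if i == 0 then x else y)%:C) in
  two_point_state t (funcalc f A) = funcalc f (two_point_state t A) /\
  two_point_state t (A ^+ 2) <> two_point_state t A ^+ 2.
Proof.
move=> xy t01 fE /=.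
have stD (u : 'I_2 -> R) : two_point_state t (diag_mx (\row_i (u i)%:C)) =
    diag_mx (\row_(i < 1) (t * u 0 + (1 - t) * u 1)%:C).
  rewrite /two_point_state !mxE !eqxx !mulr1n; apply/matrixP => i j.
  by rewrite !ord1 !mxE eqxx !mulr1n -!rmorphM -rmorphD.
have sq n (u : 'I_n -> R) : diag_mx (\row_i (u i)%:C) ^+ 2 =
    diag_mx (\row_i (u i ^+ 2)%:C) :> 'M[C]_n.
  rewrite expr2 -[LHS]/(_ *m _) mulmx_diag; congr diag_mx.
  by apply/rowP => i; rewrite !mxE -rmorphM.
split; first by rewrite funcalc_diag !stD funcalc_diag/= fE.
rewrite sq !stD sq => /matrixP/(_ 0 0); rewrite !mxE eqxx !mulr1n /= => /complexI.
move: t01; rewrite in_itv /= => /andP[t0 t1] E.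
(* The variance of the distribution with masses [t] at [x] and [1 - t] at [y]. *)
have : t * (1 - t) * (y - x) ^+ 2 = 0.
  by rewrite -(subrr (t * x ^+ 2 + (1 - t) * y ^+ 2)) {2}E; ring.
by apply/eqP; rewrite gt_eqF// !mulr_gt0// ?exprn_gt0// subr_gt0.
Qed.

End MainDirections.

Local Close Scope sesquilinear_scope.

(** * The equivalence *)

Theorem theorem1p5 (R : realType) (a b : R) (hab : a <= b) (f : R -> R)
    (hf : {within `[a, b], continuous f}) :
  (forall (n m : nat) (phi : {linear 'M[R[i]]_n -> 'M[R[i]]_m}),
     unital_map phi -> positive_map phi ->
     forall A : 'M[R[i]]_n, A \is hermsymmx -> spectrum_in A `[a, b] ->
       phi (funcalc f A) = funcalc f (phi A) ->
       forall k : nat, (1 <= k)%N -> phi (A ^+ k) = phi A ^+ k)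
  <->
  (strictly_convex_on a b f \/ strictly_concave_on a b f).
Proof.
split=> [H|[fc|fc] n m phi phi1 phip A Ah As fA k _]; last first.
(* The concave case is the convex one for the negative of [f], as the functional calculus and [phi]
   commute with negation. *)
- apply: (power_equality fc phi1 phip Ah As).
  by rewrite !funcalc_opp linearN fA.
- exact: (power_equality fc phi1 phip Ah As fA).
apply: contrapT => /not_orP[nconv nconc].
have [x [y [t [xab yab xy t01 fE]]]] := neither_convex_nor_concave hf nconv nconc.
have [fA] := affine_counterexample xy t01 fE; apply.
apply: H fA 2%N isT => //; [exact: two_point_state_unital| |exact: diag_mx_hermitian|].
- exact/two_point_state_positive/subset_itv_oo_cc.
- by apply: diag_mx_spectrum => i; case: ifP.
Qed.
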